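(* Every formula $F$ can be converted into a logically equivalent formula in conjunctive normal form, i.e. there is a formula $F'$ that is a conjunction of clauses with $F\models F'$ and $F'\models F$.
   Context: Truth domain: a linear symmetrical hedge algebra $AX=(X,G,H,\le)$ with $G=\{\bot,\mathsf{False},\mathsf{W},\mathsf{True},\top\}$, $\bot<\mathsf{False}<\mathsf{W}<\mathsf{True}<\top$ ($\bot,\mathsf{W},\top$ least, neutral, greatest), hedges $H=H^+\cup H^-$ (each part linearly ordered), $X$ the finite linearly ordered set of terms $h_n\cdots h_1a$. For $x=h_n\cdots h_1a$ with $a\in\{\mathsf{True},\mathsf{False}\}$, $\overline{x}=h_n\cdots h_1a'$ with $a'$ the other of $\mathsf{True},\mathsf{False}$ (unique contradictory element). Operations on $X$: $\alpha\wedge\beta=\min(\alpha,\beta)$, $\alpha\vee\beta=\max(\alpha,\beta)$, $\neg\alpha=\overline{\alpha}$, $\alpha\to\beta=(\neg\alpha)\vee\beta$. Syntax: atoms are propositional variables or constant symbols (elements of $X$); a literal is $A^\alpha$ with $A$ an atom and $\alpha$ a constant; formulae are literals and constants, closed under $\neg$ and the binary connectives $\vee,\wedge,\to,\leftrightarrow$. A clause is a finite disjunction $l_1\vee\cdots\vee l_n$ of literals; a formula is in conjunctive normal form if it is a conjunction of clauses. Semantics: an interpretation $I$ assigns each atom $A$ a value $I(A)\in X$ (constants denote themselves). If $I(A)=\alpha_1$: $I(A^{\alpha_2})=\alpha_1\wedge\alpha_2$ if $\alpha_1,\alpha_2>\mathsf{W}$; $=\neg(\alpha_1\vee\alpha_2)$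 if $\alpha_1,\alpha_2\le\mathsf{W}$; $=(\neg\alpha_1)\vee\alpha_2$ if $\alpha_1>\mathsf{W}\ge\alpha_2$; $=\alpha_1\vee(\neg\alpha_2)$ if $\alpha_1\le\mathsf{W}<\alpha_2$. Recursively $I(P\vee Q)=I(P)\vee I(Q)$, $I(P\wedge Q)=I(P)\wedge I(Q)$, $I(\neg P)=\neg I(P)$, $I(P\to Q)=I(P)\to I(Q)$, and $I(P\leftrightarrow Q)=I((P\to Q)\wedge(Q\to P))$. $A\models B$ iff for every interpretation $I$, $I(A)>\mathsf{W}$ implies $I(B)>\mathsf{W}$; $A$ and $B$ are logically equivalent iff $A\models B$ and $B\models A$. *)

(* Defs.v *)
From mathcomp Require Import all_boot all_order.

Set Implicit Arguments.
Unset Strict Implicit.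
Unset Printing Implicit Defensive.

Import Order.TTheory.
Local Open Scope order_scope.

Section HedgeOperations.

Variables (d : Order.disp_t) (X : finOrderType d) (H : Type).
Variable act : H -> X -> X.

(* The list [:: h_n; ...; h_1] stands for the string h_n ... h_1, so that
   [hterm s a] is the term h_n ... h_1 a. *)
Definition hterm (s : seq H) (a : X) : X := foldr act a s.

(* H(u), the set of terms generated from u; it contains u itself. *)
Definition hgen (u x : X) : Prop := exists s : seq H, x = hterm s u.

Definition hconverse (h k : H) : Prop :=
  forall x, act h x <= x <-> x <= act k x.

Definition hpositive_wrt (k h : H) : Prop :=
  forall x, (x <= act h x -> act h x <= act k (act h x)) /\
            (act h x <= x -> act k (act h x) <= act h x).

Definition hnegative_wrt (k h : H) : Prop :=
  forall x, (x <= act h x -> act k (act h x) <= act h x) /\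
            (act h x <= x -> act h x <= act k (act h x)).

(* [hle h k]: k modifies every term in the same direction as h, and at least
   as strongly. *)
Definition hle (h k : H) : Prop :=
  forall x, (x <= act h x <= act k x) \/ (act k x <= act h x <= x).

Definition hlinear (P : H -> Prop) : Prop :=
  (forall h k, P h -> P k -> hle h k \/ hle k h) /\
  (forall h k, P h -> P k -> hle h k -> hle k h -> h = k).

End HedgeOperations.

(* Hedges are total operations on the finite set X: a term which can no longer
   be modified (for instance one of maximal length) is a fixed point. *)
Record lsha (d : Order.disp_t) (X : finOrderType d) (H : Type) := LSHA {
  act : H -> X -> X;
  hpos : H -> Prop;
  hneg : H -> Prop;
  tBot : X;
  tFalse : X;
  tW : X;
  tTrue : X;
  tTop : X;
  contra : X -> X;

  bot_least : forall x, tBot <= x;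
  top_greatest : forall x, x <= tTop;
  gens_chain : [/\ tBot < tFalse, tFalse < tW, tW < tTrue & tTrue < tTop];
  gens := [:: tBot; tFalse; tW; tTrue; tTop];
  gens_generate : forall x, exists2 g, g \in gens & hgen act g x;
  (* Distinct generators are independent terms. *)
  gens_indep : forall g g', g \in gens -> g' \in gens -> hgen act g g' -> g = g';
  act_bot : forall h, act h tBot = tBot;
  act_W : forall h, act h tW = tW;
  act_top : forall h, act h tTop = tTop;

  hedge_split : forall h, hpos h \/ hneg h;
  hpos_linear : hlinear act hpos;
  hneg_linear : hlinear act hneg;
  hedge_converse : forall h k, hpos h -> hneg k -> hconverse act h k;
  hedge_signed : forall h k, hpositive_wrt act k h \/ hnegative_wrt act k h;
  hedge_inherit : forall h k h' k' x, h <> k -> act h x <= act k x ->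
    act h' (act h x) <= act k' (act k x);
  hedge_le_act : forall u v h, ~ hgen act v u -> u <= v -> u <= act h v;
  hedge_ge_act : forall u v h, ~ hgen act v u -> v <= u -> act h v <= u;

  (* Symmetry. An element may be denoted by several terms; that a function
     satisfies these equations for all of them says that the contradictory
     element is unique. *)
  contra_True : forall s, contra (hterm act s tTrue) = hterm act s tFalse;
  contra_False : forall s, contra (hterm act s tFalse) = hterm act s tTrue;
  contra_bot : contra tBot = tTop;
  contra_W : contra tW = tW;
  contra_top : contra tTop = tBot
}.

Inductive atom (V X : Type) : Type :=
| AVar of V
| AConst of X.

Inductive formula (V X : Type) : Type :=
| FLit of atom V X & X
| FConst of X
| FNot of formula V X
| FOr of formula V X & formula V X
| FAnd of formula V X & formula V X
| FImp of formula V X & formula V X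
| FIff of formula V X & formula V X.

(* Clauses and conjunctions of clauses are nonempty, and may be bracketed
   arbitrarily. *)
Inductive is_clause (V X : Type) : formula V X -> Prop :=
| ClauseLit A a : is_clause (FLit A a)
| ClauseOr C D : is_clause C -> is_clause D -> is_clause (FOr C D).

Inductive is_cnf (V X : Type) : formula V X -> Prop :=
| CnfClause C : is_clause C -> is_cnf C
| CnfAnd P Q : is_cnf P -> is_cnf Q -> is_cnf (FAnd P Q).

Section Semantics.

Variables (d : Order.disp_t) (X : finOrderType d) (H : Type).
Variable AX : lsha X H.
Variable V : Type.

Local Notation neg := (contra AX).
Local Notation W := (tW AX).

Definition imp (a b : X) : X := Order.max (neg a) b.

Definition interpretation : Type := V -> X.

Definition atom_val (I : interpretation) (A : atom V X) : X :=
  match A with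
  | AVar p => I p
  | AConst c => c
  end.

Definition lit_val (a1 a2 : X) : X :=
  match W < a1, W < a2 with
  | true, true => Order.min a1 a2
  | false, false => neg (Order.max a1 a2)
  | true, false => Order.max (neg a1) a2
  | false, true => Order.max a1 (neg a2)
  end.

Fixpoint eval (I : interpretation) (F : formula V X) : X :=
  match F with
  | FLit A a => lit_val (atom_val I A) a
  | FConst c => c
  | FNot P => neg (eval I P)
  | FOr P Q => Order.max (eval I P) (eval I Q)
  | FAnd P Q => Order.min (eval I P) (eval I Q)
  | FImp P Q => imp (eval I P) (eval I Q)
  | FIff P Q => Order.min (imp (eval I P) (eval I Q)) (imp (eval I Q) (eval I P))
  end.

Definition entails (A B : formula V X) : Prop :=
  forall I : interpretation, W < eval I A -> W < eval I B.

Definition logically_equivalent (A B : formula V X) : Prop :=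
  entails A B /\ entails B A.

End Semantics.

(* Main.v *)
Require Import Defs.
From mathcomp Require Import all_boot all_order.

(** Only the position of a value relative to [tW] matters for entailment, and
    [tW] is fixed by negation, so comparison with [tW] turns [X] into Kleene's
    three-valued logic.  There a literal [A^a] is the symmetric product of the
    signs of [A] and [a]; hence the negation of [A^a] has the sign of
    [A^(contra a)], and a constant [c] has the sign of the literal [c^tTop].
    Since De Morgan's laws and distributivity hold, every formula and its
    negation have, by simultaneous induction, a conjunctive normal form of the
    same sign. *)

Set Implicit Arguments.
Unset Strict Implicit.
Unset Printing Implicit Defensive.

Import Order.TTheory.
Local Open Scope order_scope.

Section Signs.

Variables (d : Order.disp_t) (X : finOrderType d) (H : Type) (AX : lsha X H).

Local Notation W := (tW AX).
Local Notation neg := (Defs.contra AX).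
Local Notation hterm := (hterm (act AX)).
Local Notation hgen := (hgen (act AX)).

Lemma hgen_hterm s g x : hgen (hterm s g) x -> hgen g x.
Proof. by case=> t ->; exists (t ++ s); rewrite /Defs.hterm foldr_cat. Qed.

Lemma mem_gens : [/\ tFalse AX \in gens AX, W \in gens AX & tTrue AX \in gens AX].
Proof. by rewrite !inE !eqxx !orbT. Qed.

Lemma hgen_False_W : ~ hgen (tFalse AX) W.
Proof.
have [F_gen W_gen _] := mem_gens; have [_ FW _ _] := gens_chain AX.
by move=> /(gens_indep F_gen W_gen) eFW; rewrite eFW ltxx in FW.
Qed.

Lemma hgen_True_W : ~ hgen (tTrue AX) W.
Proof.
have [_ W_gen T_gen] := mem_gens; have [_ _ WT _] := gens_chain AX.
by move=> /(gens_indep T_gen W_gen) eTW; rewrite eTW ltxx in WT.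
Qed.

(** Independence of the generators keeps [W] out of the terms generated from [tFalse]. Hence no
    hedge carries such a term across [W], by [hedge_ge_act], and none equals [W]. *)
Lemma hterm_False_lt s : hterm s (tFalse AX) < W.
Proof.
rewrite lt_neqAle; apply/andP; split.
  by apply/eqP=> e; apply: hgen_False_W; exists s.
elim: s => [|h s IHs] /=; first by have [_ /ltW] := gens_chain AX.
by apply: hedge_ge_act IHs => /hgen_hterm/hgen_False_W.
Qed.

Lemma hterm_True_gt s : W < hterm s (tTrue AX).
Proof.
rewrite lt_neqAle; apply/andP; split.
  by apply/eqP=> e; apply: hgen_True_W; exists s.
elim: s => [|h s IHs] /=; first by have [_ _ /ltW] := gens_chain AX.
by apply: hedge_le_act IHs => /hgen_hterm/hgen_True_W.
Qed.

Lemma hterm_fixed s x : (forall h, act AX h x = x) -> hterm s x = x.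
Proof. by move=> fx; elim: s => //= h s ->. Qed.

Lemma tBot_lt_tW : tBot AX < W.
Proof. by have [BF FW _ _] := gens_chain AX; apply: lt_trans BF FW. Qed.

Lemma tW_lt_tTop : W < tTop AX.
Proof. by have [_ _ WT TT] := gens_chain AX; apply: lt_trans WT TT. Qed.

Lemma contra_sign x : (W < neg x) = (x < W) /\ (neg x < W) = (W < x).
Proof.
(* The first conjunct is the claim for [y] when [neg y] is [z], the second the claim for [z] when
   [neg z] is [y]. *)
have swap y z : y < W -> W < z ->
    ((W < z) = (y < W) /\ (z < W) = (W < y)) /\
    ((W < y) = (z < W) /\ (y < W) = (W < z)).
  by move=> yW Wz; rewrite yW Wz (lt_gtF yW) (lt_gtF Wz).
have [g] := gens_generate AX x.
rewrite !inE => g_gen [s ->]; case/or4P: g_gen => [||| /orP[]] /eqP->.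
- rewrite (hterm_fixed _ (act_bot AX)) contra_bot.
  by have [] := swap _ _ tBot_lt_tW tW_lt_tTop.
- by rewrite contra_False; have [] := swap _ _ (hterm_False_lt s) (hterm_True_gt s).
- by rewrite (hterm_fixed _ (act_W AX)) contra_W.
- by rewrite contra_True; have [] := swap _ _ (hterm_False_lt s) (hterm_True_gt s).
- rewrite (hterm_fixed _ (act_top AX)) contra_top.
  by have [] := swap _ _ tBot_lt_tW tW_lt_tTop.
Qed.

Lemma contra_gtW x : (W < neg x) = (x < W).
Proof. by have [] := contra_sign x. Qed.

Lemma contra_ltW x : (neg x < W) = (W < x).
Proof. by have [] := contra_sign x. Qed.

(** Entailment sees only [W < x], but [neg] exchanges the two strict comparisons, so both must be
    tracked. *)
Definition same_sign (x y : X) : Prop := (W < x) = (W < y) /\ (x < W) = (y < W).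

Lemma same_sign_trans x y z : same_sign x y -> same_sign y z -> same_sign x z.
Proof. by rewrite /same_sign => -[-> ->]. Qed.

Lemma same_sign_max x y x' y' :
  same_sign x x' -> same_sign y y' -> same_sign (Order.max x y) (Order.max x' y').
Proof. by rewrite /same_sign !lt_max !gt_max => -[-> ->] [-> ->]. Qed.

Lemma same_sign_min x y x' y' :
  same_sign x x' -> same_sign y y' -> same_sign (Order.min x y) (Order.min x' y').
Proof. by rewrite /same_sign !lt_min !gt_min => -[-> ->] [-> ->]. Qed.

Lemma same_sign_contraK x : same_sign (neg (neg x)) x.
Proof. by rewrite /same_sign !(contra_gtW, contra_ltW). Qed.

Lemma same_sign_contra_max x y :
  same_sign (neg (Order.max x y)) (Order.min (neg x) (neg y)).
Proof.
by rewrite /same_sign contra_gtW contra_ltW lt_min gt_min gt_max lt_max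
           !(contra_gtW, contra_ltW).
Qed.

Lemma same_sign_contra_min x y :
  same_sign (neg (Order.min x y)) (Order.max (neg x) (neg y)).
Proof.
by rewrite /same_sign contra_gtW contra_ltW lt_max gt_max gt_min lt_min
           !(contra_gtW, contra_ltW).
Qed.

Lemma lit_val_gtW a b :
  (W < lit_val AX a b) = (W < a) && (W < b) || (a < W) && (b < W).
Proof.
(* Asymmetry discards the impossible sign patterns when the four comparisons are split as
   independent booleans. *)
move: (lt_asym W a) (lt_asym W b); rewrite /lit_val.
case Wa: (W < a); case Wb: (W < b); rewrite ?contra_gtW ?lt_min ?lt_max ?gt_max ?contra_gtW ?Wa ?Wb;
  by case: (a < W); case: (b < W).
Qed.

Lemma lit_val_ltW a b :
  (lit_val AX a b < W) = (W < a) && (b < W) || (a < W) && (W < b).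
Proof.
move: (lt_asym W a) (lt_asym W b); rewrite /lit_val.
case Wa: (W < a); case Wb: (W < b); rewrite ?contra_ltW ?gt_min ?gt_max ?lt_max ?contra_ltW ?Wa ?Wb;
  by case: (a < W); case: (b < W).
Qed.

Lemma same_sign_contra_lit_val a b :
  same_sign (neg (lit_val AX a b)) (lit_val AX a (neg b)).
Proof.
by rewrite /same_sign contra_gtW contra_ltW !lit_val_gtW !lit_val_ltW
           !contra_gtW !contra_ltW.
Qed.

Lemma same_sign_lit_val_top c : same_sign c (lit_val AX c (tTop AX)).
Proof.
by rewrite /same_sign lit_val_gtW lit_val_ltW tW_lt_tTop (lt_gtF tW_lt_tTop)
           !andbT !andbF orbF.
Qed.

Section Expressibility.

Variable V : Type.

Local Notation interp := (interpretation X V).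

(** Distributivity in the chain [X] gives equal values, not merely equal signs. The outer induction
    breaks up [P]; once [P] is a clause, the inner one breaks up [Q]. *)
Lemma cnf_or (P Q : formula V X) : is_cnf P -> is_cnf Q ->
  exists R : formula V X,
    is_cnf R /\ forall I, eval AX I R = Order.max (eval AX I P) (eval AX I Q).
Proof.
move=> cnfP; elim: cnfP Q => {P} [C clC|P1 P2 _ IH1 _ IH2] Q cnfQ.
  elim: cnfQ => {Q} [D clD|Q1 Q2 _ [R1 [cnf1 e1]] _ [R2 [cnf2 e2]]].
    by exists (FOr C D); split=> //; apply/CnfClause/ClauseOr.
  exists (FAnd R1 R2); split=> [|I]; first exact: CnfAnd.
  by rewrite /= e1 e2 max_minr.
have [[R1 [cnf1 e1]] [R2 [cnf2 e2]]] := (IH1 Q cnfQ, IH2 Q cnfQ).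
exists (FAnd R1 R2); split=> [|I]; first exact: CnfAnd.
by rewrite /= e1 e2 max_minl.
Qed.

(** Stated for functions of the interpretation, so that a value can be replaced by any other of the
    same sign. *)
Definition cnf_expressible (f : interp -> X) : Prop :=
  exists F : formula V X, is_cnf F /\ forall I, same_sign (f I) (eval AX I F).

Lemma cnf_expressible_same_sign (f g : interp -> X) :
  (forall I, same_sign (f I) (g I)) -> cnf_expressible g -> cnf_expressible f.
Proof.
move=> fg [F [cnfF gF]]; exists F; split=> // I.
exact: same_sign_trans (fg I) (gF I).
Qed.

Lemma cnf_expressible_lit A a :
  cnf_expressible (fun I : interp => lit_val AX (atom_val I A) a).
Proof. by exists (FLit A a); split=> //; apply/CnfClause/ClauseLit. Qed.

(** A bare [FConst c] is not a clause, so [c] enters as the atom of a literal with exponent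
    [tTop]. *)
Lemma cnf_expressible_const c : cnf_expressible (fun=> c).
Proof.
apply: (cnf_expressible_same_sign (fun=> same_sign_lit_val_top c)).
exact: (cnf_expressible_lit (AConst V c)).
Qed.

Lemma cnf_expressible_max (f g : interp -> X) :
  cnf_expressible f -> cnf_expressible g ->
  cnf_expressible (fun I => Order.max (f I) (g I)).
Proof.
move=> [P [cnfP fP]] [Q [cnfQ gQ]]; have [R [cnfR eR]] := cnf_or cnfP cnfQ.
by exists R; split=> // I; rewrite eR; apply: same_sign_max.
Qed.

Lemma cnf_expressible_min (f g : interp -> X) :
  cnf_expressible f -> cnf_expressible g ->
  cnf_expressible (fun I => Order.min (f I) (g I)).
Proof.
move=> [P [cnfP fP]] [Q [cnfQ gQ]]; exists (FAnd P Q).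
by split=> [|I]; [apply: CnfAnd | apply: same_sign_min].
Qed.

(** The strengthened induction hypothesis. Carrying the negation along takes the place of a passage
    through negation normal form. *)
Definition cnf_biexpressible (f : interp -> X) : Prop :=
  cnf_expressible f /\ cnf_expressible (fun I => neg (f I)).

Lemma cnf_biexpressible_contra (f : interp -> X) :
  cnf_biexpressible f -> cnf_biexpressible (fun I => neg (f I)).
Proof.
move=> [f_pos f_neg]; split=> //.
by apply: cnf_expressible_same_sign f_pos => I; apply: same_sign_contraK.
Qed.

Lemma cnf_biexpressible_max (f g : interp -> X) :
  cnf_biexpressible f -> cnf_biexpressible g ->
  cnf_biexpressible (fun I => Order.max (f I) (g I)).
Proof.
move=> [f_pos f_neg] [g_pos g_neg]; split; first exact: cnf_expressible_max.
apply: cnf_expressible_same_sign (cnf_expressible_min f_neg g_neg) => I.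
exact: same_sign_contra_max.
Qed.

Lemma cnf_biexpressible_min (f g : interp -> X) :
  cnf_biexpressible f -> cnf_biexpressible g ->
  cnf_biexpressible (fun I => Order.min (f I) (g I)).
Proof.
move=> [f_pos f_neg] [g_pos g_neg]; split; first exact: cnf_expressible_min.
apply: cnf_expressible_same_sign (cnf_expressible_max f_neg g_neg) => I.
exact: same_sign_contra_min.
Qed.

Lemma cnf_biexpressible_eval (F : formula V X) :
  cnf_biexpressible (fun I => eval AX I F).
Proof.
elim: F => [A a|c|P IHP|P IHP Q IHQ|P IHP Q IHQ|P IHP Q IHQ|P IHP Q IHQ] /=.
- split; first exact: cnf_expressible_lit.
  apply: cnf_expressible_same_sign (cnf_expressible_lit A (neg a)) => I.
  exact: same_sign_contra_lit_val.
- by split; apply: cnf_expressible_const.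
- exact: cnf_biexpressible_contra.
- exact: cnf_biexpressible_max.
- exact: cnf_biexpressible_min.
(* By conversion, [imp a b] is the maximum of [neg a] and [b], and the value of [FIff] is the
   minimum of two such terms. *)
- exact: cnf_biexpressible_max (cnf_biexpressible_contra IHP) IHQ.
- exact: cnf_biexpressible_min
    (cnf_biexpressible_max (cnf_biexpressible_contra IHP) IHQ)
    (cnf_biexpressible_max (cnf_biexpressible_contra IHQ) IHP).
Qed.

End Expressibility.

End Signs.

Theorem theorem1 (d : Order.disp_t) (X : finOrderType d) (H : Type)
    (AX : lsha X H) (V : Type) (F : formula V X) :
  exists F' : formula V X, is_cnf F' /\ logically_equivalent AX F F'.
Proof.
have [[F' [cnfF' sF]] _] := cnf_biexpressible_eval AX F.
(* The equality of the two tests [W < _] yields both entailments at once. *)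
by exists F'; split=> //; split=> I; have [-> _] := sF I.
Qed.
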